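(* Let $\mathtt{T}=\Box p\to p$, $\mathtt{M}=\Box\Diamond p\to\Diamond\Box p$, $\mathtt{E}=\Diamond(\Diamond p\wedge\Box q)\to\Box(\Diamond p\vee\Box q)$ and $\mathtt{Q}=(\Diamond p\wedge\Box(p\to\Box p))\to p$. Let $\mathtt{TMEQ}\pi+$ be the set of all formulas of $\mathcal{L}$ valid on every Kripke frame that validates $\mathtt{T},\mathtt{M},\mathtt{E},\mathtt{Q}$. Then $\mathsf{K}_\Pi\mathtt{TMEQ}\mathtt{Bc}\mathtt{At}^1\mathtt{R}^1\neq\mathtt{TMEQ}\pi+$.
   Context: Language. Fix a countably infinite (enumerated) set $\mathsf{Prop}$ of propositional variables. $\mathcal{L}$ is given by $\varphi::=p\mid\neg\varphi\mid(\varphi\vee\varphi)\mid\Diamond\varphi\mid\exists p\,\varphi$; $\wedge,\to,\leftrightarrow,\Box,\forall p$ are the usual abbreviations; $\mathsf{Fv}(\varphi)$ is the set of free variables. $\Diamond^0\varphi=\varphi$, $\Diamond^{k+1}\varphi=\Diamond\Diamond^k\varphi$, $\Diamond^{\le0}\varphi=\varphi$, $\Diamond^{\le k+1}\varphi=\Diamond^{\le k}\varphi\vee\Diamond^{k+1}\varphi$; $\Box^k,\Box^{\le k}$ are defined dually. Semantics. On a Kripke frame $(W,R)$ ($W\ne\varnothing$, $R\subseteq W^2$), a valuation is $v:\mathsf{Prop}\to\wp(W)$; $[\![p]\!](v)=v(p)$, $\neg,\vee$ are interpreted by complement and union, $[\![\Diamond\varphi]\!](v)=\{w\mid\exists u\in[\![\varphi]\!](v),\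 wRu\}$, $[\![\exists p\,\varphi]\!](v)=\bigcup\{[\![\varphi]\!](v[X/p])\mid X\in\wp(W)\}$, where $v[X/p]$ agrees with $v$ except for sending $p$ to $X$. $\varphi$ is valid if $[\![\varphi]\!](v)=W$ for all $v$. Substitutions. A substitution is $\sigma:\mathsf{Prop}\to\mathcal{L}$; $\sigma_p^\psi$ agrees with $\sigma$ except that it sends $p$ to $\psi$. It extends to $\mathcal{L}$ by commuting with $\neg,\vee,\Diamond$ and $\sigma(\exists p\,\varphi)=\exists q\,\sigma_p^q(\varphi)$, where $q=p$ if $p\notin\bigcup_{r\in\mathsf{Fv}(\exists p\varphi)}\mathsf{Fv}(\sigma(r))$ and otherwise $q$ is the first variable not used in $\exists p\,\varphi$ nor in any $\sigma(r)$, $r\in\mathsf{Fv}(\exists p\,\varphi)$. $\iota$ is the identity substitution. Logics. A normal propositionally quantified modal logic (NPQML) is a set $\Lambda\subseteq\mathcal{L}$ such that: all propositional tautologies are in $\Lambda$; $\Box(p\to q)\to(\Box p\to\Box q)$ and $\Diamond p\leftrightarrow\neg\Box\neg p$ are in $\Lambda$; all instances of $\iota_p^\psi(\varphi)\to\exists p\,\varphi$ are in $\Lambda$; $\varphi\in\Lambda$ implies $\Box\varphi\in\Lambda$; $\varphi,\varphi\to\psi\in\Lambda$ imply $\psi\in\Lambda$; if $\varphi\to\psi\in\Lambda$ and $p\notin\mathsf{Fv}(\psi)$ then $\exists p\,\varphi\to\psi\in\Lambda$. $\mathsf{K}_\Pi A_1\dots A_k$ is the smallest NPQML containing all (instances of)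 $A_1,\dots,A_k$. Axioms. $\mathtt{Bc}$ is the Barcan scheme $\Diamond\exists p\,\varphi\to\exists p\,\Diamond\varphi$. $\mathtt{Q}^n(\varphi)=\Diamond^{\le n}\varphi\wedge\forall p(\Box^{\le n}(\varphi\to p)\vee\Box^{\le n}(\varphi\to\neg p))$ with $p$ the first variable not in $\mathsf{Fv}(\varphi)$ (not to be confused with the axiom $\mathtt{Q}$). $\mathtt{At}^n=\forall q(\Diamond^{\le n}q\to\exists p(\mathtt{Q}^n(p)\wedge\Box^{\le n}(p\to q)))$. $\mathtt{R}^n=\forall p\exists q(\Box^{\le n}(p\to\Box q)\wedge\forall r(\Box^{\le n}(p\to\Box r)\to\Box^{\le n}(q\to r)))$. *)

(* Defs.v *)
From mathcomp Require Import all_boot.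
From mathcomp Require Import boolp classical_sets.

Set Implicit Arguments.
Unset Strict Implicit.
Unset Printing Implicit Defensive.

Local Open Scope classical_set_scope.

(* Propositional variables are enumerated as 0, 1, 2, ... *)
Definition pvar := nat.

Inductive form : Type :=
| Var of pvar
| Neg of form
| Or of form & form
| Dia of form
| Ex of pvar & form.

Definition And f g := Neg (Or (Neg f) (Neg g)).
Definition Imp f g := Or (Neg f) g.
Definition Iff f g := And (Imp f g) (Imp g f).
Definition Box f := Neg (Dia (Neg f)).
Definition All p f := Neg (Ex p (Neg f)).

Definition Dian k f := iter k Dia f.
Definition Boxn k f := iter k Box f.

Fixpoint Diale k f :=
  if k is k'.+1 then Or (Diale k' f) (Dian k f) else f.
Fixpoint Boxle k f :=
  if k is k'.+1 then And (Boxle k' f) (Boxn k f) else f.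

Fixpoint fv (f : form) : seq pvar :=
  match f with
  | Var p => [:: p]
  | Neg g | Dia g => fv g
  | Or g h => fv g ++ fv h
  | Ex p g => [seq q <- fv g | q != p]
  end.

(* All variables used in f, whether free, bound, or merely quantified. *)
Fixpoint vars (f : form) : seq pvar :=
  match f with
  | Var p => [:: p]
  | Neg g | Dia g => vars g
  | Or g h => vars g ++ vars h
  | Ex p g => p :: vars g
  end.

Definition first_notin (s : seq pvar) : pvar :=
  find (fun n => n \notin s) (iota 0 (size s).+1).

Lemma first_notin_has (s : seq pvar) :
  has (fun n => n \notin s) (iota 0 (size s).+1).
Proof.
rewrite has_predC; apply/negP => /allP sub.
have := uniq_leq_size (iota_uniq 0 (size s).+1) sub.
by rewrite size_iota ltnn.
Qed.

Lemma first_notinP (s : seq pvar) : first_notin s \notin s.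
Proof.
have h := first_notin_has s; have := nth_find 0 h.
by rewrite nth_iota ?add0n // -[X in _ < X](size_iota 0) -has_find.
Qed.

Lemma first_notin_min (s : seq pvar) n : n < first_notin s -> n \in s.
Proof.
move=> lt_n; have := before_find 0 lt_n.
rewrite nth_iota ?add0n; first by move/negbFE.
apply: (ltn_trans lt_n).
by rewrite -[X in _ < X](size_iota 0) -has_find first_notin_has.
Qed.

Definition upd (A : Type) (s : pvar -> A) (p : pvar) (a : A) : pvar -> A :=
  fun q => if q == p then a else s q.

Definition subst_bvar (s : pvar -> form) (p : pvar) (f : form) : pvar :=
  let rs := fv (Ex p f) in
  if p \notin flatten [seq fv (s r) | r <- rs] then p
  else first_notin (vars (Ex p f) ++ flatten [seq vars (s r) | r <- rs]).

Fixpoint subst (s : pvar -> form) (f : form) : form :=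
  match f with
  | Var p => s p
  | Neg g => Neg (subst s g)
  | Or g h => Or (subst s g) (subst s h)
  | Dia g => Dia (subst s g)
  | Ex p g => let q := subst_bvar s p g in Ex q (subst (upd s p (Var q)) g)
  end.

Definition instances (f : form) : set form := [set subst s f | s in setT].

Record frame := Frame {
  world :> Type;
  acc : world -> world -> Prop;
  world_inhabited : inhabited world }.

Fixpoint eval (F : frame) (v : pvar -> set F) (f : form) : set F :=
  match f with
  | Var p => v p
  | Neg g => ~` eval v g
  | Or g h => eval v g `|` eval v h
  | Dia g => [set w | exists2 u, eval v g u & acc w u]
  | Ex p g => \bigcup_(X in setT) eval (upd v p X) g
  end.

Definition valid (F : frame) (f : form) : Prop :=
  forall v : pvar -> set F, eval v f = setT.

(* Formulas not of the form Neg or Or are treated as atoms, so that a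
   tautology is a substitution instance, in the full language, of a classical
   propositional tautology. *)
Fixpoint bool_eval (e : form -> bool) (f : form) : bool :=
  match f with
  | Neg g => ~~ bool_eval e g
  | Or g h => bool_eval e g || bool_eval e h
  | _ => e f
  end.

Definition tautology (f : form) : Prop := forall e, bool_eval e f.

Record NPQML (L : set form) : Prop := {
  npqml_taut : forall f, tautology f -> L f;
  npqml_K : forall p q,
    L (Imp (Box (Imp (Var p) (Var q)))
           (Imp (Box (Var p)) (Box (Var q))));
  npqml_dual : forall p, L (Iff (Dia (Var p)) (Neg (Box (Neg (Var p)))));
  npqml_ex_intro : forall p f g, L (Imp (subst (upd Var p g) f) (Ex p f));
  npqml_nec : forall f, L f -> L (Box f);
  npqml_mp : forall f g, L f -> L (Imp f g) -> L g;
  npqml_ex_elim : forall p f g,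
    L (Imp f g) -> p \notin fv g -> L (Imp (Ex p f) g) }.

(* A is the set of all instances of the axioms. *)
Definition KPi (A : set form) : set form := smallest NPQML A.

Definition axT : form := Imp (Box (Var 0)) (Var 0).
Definition axM : form := Imp (Box (Dia (Var 0))) (Dia (Box (Var 0))).
Definition axE : form :=
  Imp (Dia (And (Dia (Var 0)) (Box (Var 1))))
      (Box (Or (Dia (Var 0)) (Box (Var 1)))).
Definition axQ : form :=
  Imp (And (Dia (Var 0)) (Box (Imp (Var 0) (Box (Var 0))))) (Var 0).

Definition Bc : set form :=
  [set f | exists p g, f = Imp (Dia (Ex p g)) (Ex p (Dia g))].

Definition Qn (n : nat) (f : form) : form :=
  let p := first_notin (fv f) in
  And (Diale n f)
      (All p (Or (Boxle n (Imp f (Var p))) (Boxle n (Imp f (Neg (Var p)))))).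

Definition Atn (n : nat) : form :=
  let p := 0 in let q := 1 in
  All q (Imp (Diale n (Var q))
             (Ex p (And (Qn n (Var p)) (Boxle n (Imp (Var p) (Var q)))))).

Definition Rn (n : nat) : form :=
  let p := 0 in let q := 1 in let r := 2 in
  All p (Ex q (And (Boxle n (Imp (Var p) (Box (Var q))))
                   (All r (Imp (Boxle n (Imp (Var p) (Box (Var r))))
                               (Boxle n (Imp (Var q) (Var r))))))).

Definition TMEQpi : set form :=
  [set f | forall F : frame,
     valid F axT -> valid F axM -> valid F axE -> valid F axQ -> valid F f].

(* Main.v *)
Require Import Defs.
From mathcomp Require Import all_boot.
From mathcomp Require Import boolp classical_sets.
From mathcomp Require Import zify.

Set Implicit Arguments.
Unset Strict Implicit.
Unset Printing Implicit Defensive.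

Local Open Scope classical_set_scope.

(** The formula [p -> Box p] separates the two logics.

    On a Kripke frame validating T, M and Q every world sees only itself.  By
    Q, every successor u of a world w has a path back to w inside R[w]; if w
    has a successor other than itself, the set of successors of w at even
    distance from w refutes M at w, since each successor of w sees successors
    of w at both parities.

    On the other hand, consider the recession frame (nat, m R n iff m <= n+1),
    with propositional quantifiers ranging over the eventually constant subsets
    of nat.  A formula of modal depth d only inspects the worlds above w - d
    when evaluated at w, and these final segments are all isomorphic; hence
    eventually constant sets are closed under all definable operations, and
    the formulas valid in this structure form an NPQML.  It contains all the
    axioms but not [p -> Box p], as 0 sees 1. *)

(** * Frames for T, M and Q *)

Section Distance.

Variables (W : Type) (R : W -> W -> Prop) (w : W).
Hypothesis R_refl : forall x, R x x.

(** The path back to [w] stays among the successors of [w], since the antecedent of [axQ] controls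
    only those worlds. *)
Fixpoint returns (n : nat) (u : W) : Prop :=
  if n is n'.+1 then R w u /\ exists2 t, R u t & returns n' t else u = w.

Definition distance (n : nat) (u : W) : Prop :=
  returns n u /\ forall m, returns m u -> n <= m.

Lemma returns_succ n u : returns n u -> R w u.
Proof. by case: n => [->|n []]. Qed.

Lemma distance_inj m n u : distance m u -> distance n u -> m = n.
Proof.
move=> [rm minm] [rn minn]; apply/eqP.
by rewrite eqn_leq (minm _ rn) (minn _ rm).
Qed.

Lemma distance_ex n u : returns n u -> exists m, distance m u.
Proof.
move=> rn; have ex : exists k, `[< returns k u >] by exists n; apply/asboolP.
exists (ex_minn ex); case: ex_minnP => m /asboolP rm minm.
by split=> // k rk; apply: minm; apply/asboolP.
Qed.

Lemma distance_step n u : distance n.+1 u -> exists2 t, R u t & distance n t.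
Proof.
move=> [[wu [t ut rt]] minu]; exists t => //; split=> // m rm.
by apply: (minu m.+1); split=> //; exists t.
Qed.

(** Along a shortest path, the last world before [w] is at distance 1. *)
Lemma distance_neq n u : u <> w -> distance n u -> exists t, distance 1 t.
Proof.
elim: n u => [|n IH] u uw du; first by case: du.
have [t ut dt] := distance_step du.
have [tw|] := pselect (t = w); last by move=> tw; apply: IH dt.
have d0 : distance 0 t by [].
by exists u; rewrite (distance_inj d0 dt).
Qed.

End Distance.

Lemma TMQ_frame_trivial (F : frame) :
  valid F axT -> valid F axM -> valid F axQ ->
  forall w u : F, acc w u -> u = w.
Proof.
move=> vT vM vQ w u0 wu0; apply: contrapT => u0w.
have R_refl (x : F) : acc x x.
  have: eval (fun _ => acc x) axT x by rewrite vT.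
  by move=> /= [] // h; exfalso; apply: h => -[y ny xy]; apply: ny.
have ret u : acc w u -> exists n, returns (@acc F) w n u.
  move=> wu; apply: contrapT => nu.
  (* A step from a successor of [w] lying in [P] stays in [P]. So if [u] were in [P], then [axQ]
     would put [w] there too, yet [w] returns in 0 steps. *)
  pose P (x : F) := ~ exists n, returns (@acc F) w n x.
  have: eval (fun _ => P) axQ w by rewrite vQ.
  move=> /= [h|]; last by apply; exists 0.
  apply: h => -[h|h]; first by apply: h; exists u.
  apply: h => -[x /not_orP[/contrapT Px h] wx]; apply: h => -[y ny xy].
  apply: ny => -[n rn]; apply: Px; exists n.+1; split=> //.
  by exists y.
have dist u : acc w u -> exists n, distance (@acc F) w n u.
  by move=> /ret[n]; apply: distance_ex.
have [t1 dt1] : exists t, distance (@acc F) w 1 t.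
  by have [n dn] := dist _ wu0; apply: distance_neq dn.
have other_parity x n : distance (@acc F) w n x ->
    exists t m, [/\ acc x t, distance (@acc F) w m t & odd m = ~~ odd n].
  case: n => [|n] dn.
    by exists t1, 1; split=> //; case: dn => -> _; case: dt1 => -[].
  have [t xt dt] := distance_step dn.
  by exists t, n; split=> //=; rewrite negbK.
pose P (x : F) := exists2 n, distance (@acc F) w n x & ~~ odd n.
have: eval (fun _ => P) axM w by rewrite vM.
(* Either some successor of [w] sees no even world, or some successor sees only even ones. *)
move=> /= [/contrapT[x h wx]|[x h wx]]; have [n dn] := dist _ wx.
  apply: h; have [en|en] := boolP (odd n); last by exists x => //; exists n.
  have [t [m [xt dm om]]] := other_parity _ _ dn.
  by exists t => //; exists m; rewrite // om en.
have all_P y : acc x y -> P y.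
  by move=> xy; apply: contrapT => ny; apply: h; exists y.
have [k dk ek] := all_P x (R_refl x).
have [t [m [xt dm om]]] := other_parity _ _ dk.
have [j dj] := all_P t xt.
by rewrite (distance_inj dj dm) om ek.
Qed.

(** * The recession frame *)

(** These are exactly the finite and the cofinite sets. *)
Definition ev_const (X : set nat) : Prop :=
  exists N, forall m, N <= m -> (X m <-> X N).

Fixpoint sat (v : pvar -> set nat) (f : form) (w : nat) : Prop :=
  match f with
  | Var p => v p w
  | Neg g => ~ sat v g w
  | Or g h => sat v g w \/ sat v h w
  | Dia g => exists2 u, w <= u.+1 & sat v g u
  | Ex p g => exists2 X, ev_const X & sat (upd v p X) g w
  end.

Lemma sat_Dia v f w :
  sat v (Dia f) w <-> exists2 u, w <= u.+1 & sat v f u.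
Proof. by []. Qed.

Lemma sat_Ex v p f w :
  sat v (Ex p f) w <-> exists2 X, ev_const X & sat (upd v p X) f w.
Proof. by []. Qed.

Lemma sat_And v f g w : sat v (And f g) w <-> sat v f w /\ sat v g w.
Proof.
split=> [/= /not_orP[/contrapT hf /contrapT hg]|[hf hg] /= []] //.
Qed.

Lemma sat_Imp v f g w : sat v (Imp f g) w <-> (sat v f w -> sat v g w).
Proof.
split=> [/= [] //|h /=].
by have [/h|] := pselect (sat v f w); [right|left].
Qed.

Lemma sat_Box v f w :
  sat v (Box f) w <-> forall u, w <= u.+1 -> sat v f u.
Proof.
split=> [h u wu|h /= [u wu]]; last by apply; apply: h.
by apply: contrapT => nf; apply: h; exists u.
Qed.

Lemma sat_All v p f w :
  sat v (All p f) w <-> forall X, ev_const X -> sat (upd v p X) f w.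
Proof.
split=> [h X cX|h /= [X cX]]; last by apply; apply: h.
by apply: contrapT => nf; apply: h; exists X.
Qed.

Lemma sat_Boxle1 v f w :
  sat v (Boxle 1 f) w <-> forall u, w <= u.+1 -> sat v f u.
Proof.
rewrite [Boxle 1 f]/(And f (Box f)) sat_And sat_Box.
by split=> [[]|h] //; split=> //; apply: h.
Qed.

Lemma sat_Diale1 v f w :
  sat v (Diale 1 f) w <-> exists2 u, w <= u.+1 & sat v f u.
Proof. by split=> [/= []|h] //; [exists w | right]. Qed.

Lemma sat_ext v v' f w :
  (forall p, p \in fv f -> forall u, v p u <-> v' p u) ->
  sat v f w <-> sat v' f w.
Proof.
elim: f v v' w => [p|f IH|f IHf g IHg|f IH|p f IH] v v' w /= h.
- by apply: h; rewrite inE.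
- by rewrite (IH v v').
- rewrite (IHf v v') ?(IHg v v') // => p pin; apply: h;
  by rewrite mem_cat pin ?orbT.
- by split=> -[u wu] /IH hu; exists u => //; apply: hu => // p pin u'; split=> /h; apply.
- suff e X : sat (upd v p X) f w <-> sat (upd v' p X) f w.
    by split=> -[X cX] /e hX; exists X.
  apply: IH => q qin u; rewrite /upd; case: eqVneq => // qp.
  by apply: h; rewrite mem_filter qp.
Qed.

(** * Locality of satisfaction and eventual constancy of definable sets *)

Fixpoint modal_depth (f : form) : nat :=
  match f with
  | Var _ => 0
  | Neg g | Ex _ g => modal_depth g
  | Or g h => maxn (modal_depth g) (modal_depth h)
  | Dia g => (modal_depth g).+1
  end.

Lemma ev_const_shift X a b :
  ev_const X -> ev_const (fun m => X (a + (m - b))).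
Proof.
by move=> [N cX]; exists (N + b) => m le; rewrite (cX (a + _)) 1?(cX (a + (_ + _ - _))) //; lia.
Qed.

(** Each diamond descends by at most one world and uses up one unit of depth, so nothing below [a]
    is reached from [a + k]. Translation matches the final segments from [a] and [b]. *)
Lemma sat_shift v v' f a b k :
  modal_depth f <= k ->
  (forall p, p \in fv f -> forall j, v p (a + j) <-> v' p (b + j)) ->
  sat v f (a + k) <-> sat v' f (b + k).
Proof.
elim: f v v' a b k => [p|f IH|f IHf g IHg|f IH|p f IH] v v' a b k /= dk h.
- by apply: h; rewrite inE.
- by rewrite (IH v v' a b).
- move: dk; rewrite geq_max => /andP[df dg].
  rewrite (IHf v v' a b) ?(IHg v v' a b) // => p pin; apply: h;
  by rewrite mem_cat pin ?orbT.
- have step v1 v2 c d :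
      (forall p, p \in fv f -> forall j, v1 p (c + j) <-> v2 p (d + j)) ->
      (exists2 u, c + k <= u.+1 & sat v1 f u) ->
      exists2 u, d + k <= u.+1 & sat v2 f u.
    move=> h12 [u le]; have -> : u = c + (u - c) by lia.
    by move/(IH v1 v2 c d) => su; exists (d + (u - c)); [lia | apply: su => //; lia].
  by split; apply: step => // p pin j; split=> /h; apply.
- have step v1 v2 c d :
      (forall q, q \in [seq q <- fv f | q != p] ->
        forall j, v1 q (c + j) <-> v2 q (d + j)) ->
      (exists2 X, ev_const X & sat (upd v1 p X) f (c + k)) ->
      exists2 X, ev_const X & sat (upd v2 p X) f (d + k).
    move=> h12 [X cX sX]; exists (fun m => X (c + (m - d))).
      exact: ev_const_shift.
    apply: (iffLR (IH _ _ c d k dk _)) sX => q qin j.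
    rewrite /upd; case: eqVneq => [_|qp]; first by rewrite addKn.
    by apply: h12; rewrite mem_filter qp.
  by split; apply: step => // q qin j; split=> /h; apply.
Qed.

(** Infinitely many variables may lack a common threshold, but a formula has finitely many free
    ones. *)
Lemma ev_const_uniform (v : pvar -> set nat) (s : seq pvar) :
  (forall p, ev_const (v p)) ->
  exists N, forall p, p \in s -> forall m, N <= m -> (v p m <-> v p N).
Proof.
move=> cv; elim: s => [|q s [N hN]]; first by exists 0.
have [M hM] := cv q; exists (maxn M N) => p.
rewrite inE => /predU1P[->|ps] m; rewrite geq_max => /andP[le1 le2].
  by rewrite hM // (hM (maxn M N)) // leq_maxl.
by rewrite hN // (hN _ _ (maxn M N)) // leq_maxr.
Qed.

(** Beyond the common threshold all final segments carry the same valuation, so [sat_shift] applies.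
    This makes truth sets admissible witnesses for quantifiers. *)
Lemma ev_const_sat v f :
  (forall p, ev_const (v p)) -> ev_const (sat v f).
Proof.
move=> /(@ev_const_uniform _ (fv f))[N hN].
exists (N + modal_depth f) => m le.
have -> : m = (m - modal_depth f) + modal_depth f by lia.
apply: sat_shift => // p pin j.
by rewrite (hN _ pin) 1?(hN _ pin (N + j)) //; lia.
Qed.

Lemma ev_const_upd v p X :
  (forall q, ev_const (v q)) -> ev_const X ->
  forall q, ev_const (upd v p X q).
Proof. by move=> cv cX q; rewrite /upd; case: eqP. Qed.

(** * Capture-avoiding substitution *)

Lemma fv_vars f : {subset fv f <= vars f}.
Proof.
elim: f => [p|f IH|f IHf g IHg|f IH|p f IH] q //=; try exact: IH.
  by rewrite !mem_cat => /orP[/IHf ->|/IHg ->]; rewrite ?orbT.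
by rewrite mem_filter inE => /andP[_ /IH ->]; rewrite orbT.
Qed.

(** Rules out variable capture in the quantifier case of [sat_subst]. *)
Lemma subst_bvar_fresh s p f r :
  r \in fv (Ex p f) -> subst_bvar s p f \notin fv (s r).
Proof.
move=> rin; rewrite /subst_bvar; case: ifPn => [|_].
  by apply: contra => pin; apply/flatten_mapP; exists r.
set l := _ ++ _; have := first_notinP l; apply: contra => /fv_vars qin.
by rewrite mem_cat; apply/orP; right; apply/flatten_mapP; exists r.
Qed.

Lemma sat_subst v s f w :
  sat v (subst s f) w <-> sat (fun p => sat v (s p)) f w.
Proof.
elim: f v s w => [p|f IH|f IHf g IHg|f IH|p f IH] v s w //=.
- by rewrite IH.
- by rewrite IHf IHg.
- by split=> -[u wu] /IH hu; exists u.
- set q := subst_bvar s p f.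
  suff e X : sat (upd v q X) (subst (upd s p (Var q)) f) w <->
             sat (upd (fun r => sat v (s r)) p X) f w.
    by split=> -[X cX] /e hX; exists X.
  rewrite IH; apply: sat_ext => r rin u.
  rewrite {2 3}/upd; case: eqVneq => [_|rp] /=; first by rewrite /upd eqxx.
  apply: sat_ext => t tin u'; rewrite /upd; case: eqVneq => // tq.
  have /negP[] : q \notin fv (s r).
    by apply: subst_bvar_fresh; rewrite mem_filter rp.
  by rewrite -tq.
Qed.

(** * The logic of the recession frame *)

Definition recession_logic : set form :=
  [set f | forall v, (forall p, ev_const (v p)) -> forall w, sat v f w].

Lemma recession_tautology f : tautology f -> recession_logic f.
Proof.
move=> tf v _ w; pose e g := `[< sat v g w >].
have e_sat g : bool_eval e g <-> sat v g w.
  elim: g => [p|g IH|g IHg k IHk|g IH|p g IH] /=; try by split=> /asboolP.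
  - by rewrite -IH; split=> [/negP|h]; last apply/negP.
  - by rewrite -IHg -IHk; split=> [/orP|h]; last apply/orP.
exact/e_sat.
Qed.

Lemma recession_NPQML : NPQML recession_logic.
Proof.
split.
- exact: recession_tautology.
- move=> p q v _ w; rewrite !sat_Imp !sat_Box => hpq hp u wu.
  by move: (hpq u wu); rewrite sat_Imp; apply; apply: hp.
- move=> p v _ w; rewrite sat_And !sat_Imp; split=> [[u wu pu]|].
    by rewrite /= => h; apply: h; exists u => //=; apply.
  by move=> /= /contrapT[u wu /contrapT pu]; exists u.
- move=> p f g v cv w; rewrite sat_Imp sat_subst => h.
  exists (sat v g); first exact: ev_const_sat.
  by apply: (iffLR (sat_ext _ _)) h => q _ u; rewrite /upd; case: eqP.
- by move=> f hf v cv w; rewrite sat_Box => u _; apply: hf.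
- by move=> f g hf hfg v cv w; have := hfg v cv w; rewrite sat_Imp; apply; apply: hf.
- move=> p f g hfg pg v cv w; rewrite sat_Imp => -[X cX hX].
  have := hfg _ (ev_const_upd p cv cX) w; rewrite sat_Imp => /(_ hX).
  apply: (iffLR (sat_ext _ _)) => q qg u; rewrite /upd; case: eqVneq => // qp.
  by rewrite -qp qg in pg.
Qed.

Lemma recession_instances f :
  recession_logic f -> instances f `<=` recession_logic.
Proof.
move=> hf _ [s _ <-] v cv w; apply/sat_subst/hf => p.
exact: ev_const_sat.
Qed.

(** * Soundness of the axioms *)

Lemma recession_T : recession_logic axT.
Proof. by move=> v _ w; rewrite sat_Imp sat_Box; apply. Qed.

(** A variable true somewhere beyond its threshold is true everywhere beyond it. The successor in
    [(maxn w N).+1] absorbs the one step back that the relation allows. *)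
Lemma recession_M : recession_logic axM.
Proof.
move=> v cv w; rewrite sat_Imp sat_Box => h; have [N hN] := cv 0.
have [|x le vx] := h (maxn w N).+1; first lia.
have vN : v 0 N by have [|vN _] := hN x; [lia | apply: vN].
exists (maxn w N).+1; first lia.
by rewrite sat_Box => y le_y; have [|_] := hN y; [lia | apply].
Qed.

Lemma recession_E : recession_logic axE.
Proof.
move=> v _ w; rewrite sat_Imp sat_Dia => -[x wx /sat_And[[k xk vk] /sat_Box hq]].
rewrite sat_Box => y wy.
(* If [y] is too high to see [k], it lies above [x], so every world it sees is seen by [x]. *)
have [yk|ky] := leqP y k.+1; first by left; exists k.
by right; rewrite sat_Box => z yz; apply: hq; lia.
Qed.

Lemma recession_Q : recession_logic axQ.
Proof.
move=> v _ w; rewrite sat_Imp sat_And sat_Dia sat_Box => -[[k wk vk] h].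
have step x y : w <= x.+1 -> x <= y.+1 -> v 0 x -> v 0 y.
  by move=> wx xy vx; have := h x wx; rewrite sat_Imp sat_Box => /(_ vx y xy).
have [kw|] := leqP k w; first by apply: step vk; lia.
(* When [k] exceeds [w], truth is carried down to [w] one world at a time. *)
elim: k wk vk => // k IH _ vk wk.
have vk' : v 0 k by apply: step vk; lia.
by have [/IH|kw] := ltnP w k; [apply=> //; lia | apply: step vk'; lia].
Qed.

Lemma recession_Bc : Bc `<=` recession_logic.
Proof.
move=> _ [p [g ->]] v _ w; rewrite sat_Imp => -[u wu [X cX hX]].
by exists X => //; exists u.
Qed.

Lemma ev_const_set1 (x : nat) : ev_const [set x].
Proof. by exists x.+1 => m le; split=> /= e; exfalso; lia. Qed.

Lemma recession_At1 : recession_logic (Atn 1).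
Proof.
move=> v _ w; rewrite sat_All => X _; rewrite sat_Imp sat_Diale1 sat_Ex => -[x wx Xx].
(* Singletons act as the atoms. *)
exists [set x]; first exact: ev_const_set1.
rewrite /Qn 2!sat_And sat_Diale1 sat_All sat_Boxle1; split; first split.
- by exists x.
- move=> Y _; have [Yx|nYx] := pselect (Y x); [left|right];
  by rewrite sat_Boxle1 => u wu; rewrite sat_Imp /= => ->.
- by move=> u wu; rewrite sat_Imp /= => ->.
Qed.

Lemma ev_const_upclosed (X : set nat) :
  (forall m n, m <= n -> X m -> X n) -> ev_const X.
Proof.
move=> up; have [[N XN]|nX] := pselect (exists n, X n).
  by exists N => m le; split=> // _; apply: up XN.
by exists 0 => m _; split=> h; exfalso; apply: nX; [exists m | exists 0].
Qed.

Lemma recession_R1 : recession_logic (Rn 1).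
Proof.
move=> v _ w; rewrite sat_All => X _; rewrite sat_Ex.
(* The least candidate: all worlds seen from those [X]-worlds that [w] sees. It is upward closed,
   hence eventually constant. *)
exists [set n | exists2 m, w <= m.+1 & X m /\ m <= n.+1].
  apply: ev_const_upclosed => m n le [k wk [Xk km]].
  by exists k => //; split=> //; lia.
rewrite sat_And sat_Boxle1 sat_All; split=> [m wm|Z _].
  by rewrite sat_Imp sat_Box => Xm n mn; exists m.
rewrite sat_Imp !sat_Boxle1 => h n wn; rewrite sat_Imp => -[m wm [Xm mn]].
by have := h m wm; rewrite sat_Imp sat_Box => /(_ Xm n mn).
Qed.

(** * The separating formula *)

Definition persistence : form := Imp (Var 0) (Box (Var 0)).

Lemma persistence_TMEQpi : TMEQpi persistence.
Proof.
move=> F vT vM _ vQ v; apply/seteqP; split=> // w _ /=.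
have [vw|] := pselect (v 0 w); last by left.
right=> -[u nu wu]; apply: nu.
by rewrite (TMQ_frame_trivial vT vM vQ wu).
Qed.

Lemma persistence_recession : ~ recession_logic persistence.
Proof.
move=> /(_ (fun _ => [set 0]) (fun _ => @ev_const_set1 0) 0).
by rewrite sat_Imp sat_Box => /(_ erefl 1 erefl).
Qed.

Theorem theorem6p1 :
  KPi (instances axT `|` instances axM `|` instances axE `|` instances axQ
       `|` Bc `|` instances (Atn 1) `|` instances (Rn 1))
  <> TMEQpi.
Proof.
move=> eqL; apply: persistence_recession.
(* By minimality, [KPi] lies inside every NPQML containing the axioms, in particular
   [recession_logic]. *)
have := persistence_TMEQpi; rewrite -eqL; apply; split.
  exact: recession_NPQML.
rewrite !subUset; repeat split; try apply: recession_instances.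
- exact: recession_T.
- exact: recession_M.
- exact: recession_E.
- exact: recession_Q.
- exact: recession_Bc.
- exact: recession_At1.
- exact: recession_R1.
Qed.
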